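(* Let $l$ be a positive integer and $\alpha\in\mathbb{C}$. Then for $p=0,1,\dots,l$, $$\boldsymbol{F}^{(2l-p,p)}_{2,l}(\alpha)=\sum_{s=0}^l\binom ls Q_p(s;-l-1,-l-1,l)\,\alpha^s=(1+\alpha)^{l-p}G_p^l(\alpha).$$
   Context: $\mathfrak{S}_{2l}$ is the symmetric group on $[2l]=\{1,\dots,2l\}$. For $\sigma\in\mathfrak{S}_{2l}$, $\nu(\sigma)=\sum_{i\ge1}(i-1)m_i(\sigma)$, where $m_i(\sigma)$ is the number of $i$-cycles of $\sigma$; the convention $0^0=1$ is used. Put $$K=\{g\in\mathfrak{S}_{2l} : \lceil g(x)/l\rceil=\lceil x/l\rceil \text{ for all } x\in[2l]\},\qquad H=\{g\in\mathfrak{S}_{2l} : g(x)\equiv x \pmod l\text{ for all } x\in[2l]\},$$ so $K\cong\mathfrak{S}_l\times\mathfrak{S}_l$ and $H\cong\mathfrak{S}_2^l$ is generated by the transpositions $(i,\,l+i)$, $1\le i\le l$. For a partition $\lambda=(2l-p,p)$ of $2l$ with $0\le p\le l$, let $\mathcal{S}^\lambda$ be the irreducible unitary right $\mathfrak{S}_{2l}$-module corresponding to $\lambda$, with invariant inner product $\langle\cdot,\cdot\rangle$. Its space of $K$-invariant vectors is one-dimensional (since $(\mathfrak{S}_{2l},K)$ is a Gelfand pair and the Kostka number $K_{\lambda(l^2)}$ equals $1$); let $\boldsymbol{e}^\lambda$ be a $K$-invariant unit vector. The (size $1$) transition matrix is the polynomial $$\boldsymbol{F}^{\lambda}_{2,l}(\alpha)=\sum_{h\in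 H}\alpha^{\nu(h)}\langle\boldsymbol{e}^\lambda\cdot h,\boldsymbol{e}^\lambda\rangle=\sum_{h\in H}\alpha^{\nu(h)}\omega^\lambda(h),$$ where $\omega^\lambda(g)=\frac1{|K|}\sum_{k\in K}\chi^\lambda(kg)$ is the zonal spherical function and $\chi^\lambda$ is the irreducible character of $\mathfrak{S}_{2l}$ corresponding to $\lambda$. The Hahn polynomial is $$Q_n(x;a,b,N)=\sum_{j=0}^N(-1)^j\binom nj\binom{-n-a-b-1}j\binom{-a-1}j^{-1}\binom Nj^{-1}\binom xj,$$ so that $$Q_p(s;-l-1,-l-1,l)=\sum_{j=0}^p(-1)^j\binom pj\binom{2l-p+1}j\binom lj^{-2}\binom sj.$$ The polynomial $G_p^l$ is $$G_p^l(x)=\sum_{j=0}^p(-1)^j\binom pj\binom{l-p+j}j\binom lj^{-1}x^j.$$ *)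

(* Defs.v *)
From HB Require Import structures.
From mathcomp Require Import all_boot all_order all_algebra all_fingroup.
From mathcomp Require Import mxrepresentation sesquilinear complex reals.

Set Implicit Arguments.
Unset Strict Implicit.
Unset Printing Implicit Defensive.

Import Order.TTheory GRing.Theory Num.Theory GroupScope.
Local Open Scope ring_scope.

(** Permutations of {1, ..., n} are encoded as permutations of 'I_n, the point
    x of {1, ..., n} being the ordinal x - 1.  The product of 'S_n is
    [(s * t) x = t (s x)], and representations act on row vectors from the
    right, so that [mx_representation] is the notion of right module. *)

Section CycleStatistic.
Variables (n : nat) (s : 'S_n).

Definition ncycles (i : nat) : nat := #|[set c in porbits s | #|c| == i]|.

Definition nu : nat := (\sum_(1 <= i < n.+1) (i - 1) * ncycles i)%N.

End CycleStatistic.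

(** [la] is the list of the parts of a partition of [n] (trailing zeros are
    harmless).  Filling the diagram of [la] with 0, ..., n - 1 row after row, the
    entry x lies in row [reshape_index la x] and column [reshape_offset la x]. *)
Section Specht.
Variables (C : fieldType) (n : nat) (la : seq nat).

Definition row_stab : {set 'S_n} :=
  [set g : 'S_n | [forall x, reshape_index la (g x) == reshape_index la x]].

Definition col_stab : {set 'S_n} :=
  [set g : 'S_n | [forall x, reshape_offset la (g x) == reshape_offset la x]].

(* An element of the group algebra is a row vector of coordinates, on which
   [regular_repr] acts by right multiplication. *)
Definition young_symmetrizer : 'rV[C]_(gcard [set: 'S_n]) :=
  \sum_(r in row_stab) \sum_(q in col_stab)
    (-1) ^+ odd_perm q *: delta_mx 0 (gring_index [set: 'S_n] (r * q)%g).

(* The Specht module is the right ideal generated by the Young symmetrizer,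
   written in a basis ([submod_repr]). *)
Definition specht_mx :=
  cyclic_mx (regular_repr C [set: 'S_n]) young_symmetrizer.

Definition specht : mx_representation C [set: 'S_n] (\rank specht_mx) :=
  submod_repr (cyclic_mx_module (regular_repr C [set: 'S_n]) young_symmetrizer).

Definition chi (g : 'S_n) : C := \tr (specht g).

End Specht.

Section Transition.
Variable l : nat.

(* For the point y = x + 1 of {1, ..., 2l}, [x %/ l] is the ceiling of y / l
   minus 1. *)

Definition Kset : {set 'S_(2 * l)} :=
  [set g : 'S_(2 * l) | [forall x, g x %/ l == x %/ l]%N].

Definition Hset : {set 'S_(2 * l)} :=
  [set g : 'S_(2 * l) | [forall x, g x == x %[mod l]]%N].

Variables (C : numClosedFieldType) (la : seq nat).

Local Notation S := (specht C (2 * l) la).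
Local Notation V := 'rV[C]_(\rank (specht_mx C (2 * l) la)).

Definition omega (g : 'S_(2 * l)) : C :=
  #|Kset|%:R^-1 * \sum_(k in Kset) chi C la (k * g)%g.

(* The transition matrix, via the zonal spherical function [omega].  [Fdot]
   below is its expression via a K-invariant unit vector [e]. *)
Definition Fomega (alpha : C) : C := \sum_(h in Hset) alpha ^+ nu h * omega h.

Definition invariant_dot (dot : {dot V for Num.conj}) : Prop :=
  forall (g : 'S_(2 * l)) (u v : V), dot (u *m S g) (v *m S g) = dot u v.

Definition K_invariant (e : V) : Prop := forall k, k \in Kset -> e *m S k = e.

Definition Fdot (dot : {dot V for Num.conj}) (e : V) (alpha : C) : C :=
  \sum_(h in Hset) alpha ^+ nu h * dot (e *m S h) e.

End Transition.

Section Polynomials.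
Variable C : fieldType.

(* Binomial coefficient with an arbitrary (e.g. negative) upper argument. *)
Definition gbinom (x : C) (j : nat) : C :=
  (\prod_(i < j) (x - i%:R)) / (j`!)%:R.

Definition hahn (n : nat) (x a b : C) (N : nat) : C :=
  \sum_(j < N.+1) (-1) ^+ j * 'C(n, j)%:R * gbinom (- n%:R - a - b - 1) j
    * (gbinom (- a - 1) j)^-1 * ('C(N, j)%:R)^-1 * gbinom x j.

Definition Gpoly (p l : nat) (x : C) : C :=
  \sum_(j < p.+1) (-1) ^+ j * 'C(p, j)%:R * 'C(l - p + j, j)%:R
    * ('C(l, j)%:R)^-1 * x ^+ j.

End Polynomials.

(* Main.v *)
(** Coefficients of elements of the Specht module are functions [phi] on the
    symmetric group, invariant on the left under the row stabilizer and harmonic: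
    for [b] in the bottom row, the sum of [phi (tperm b y * g)] over the [y] that
    are outside the rest of the bottom row vanishes.  If [phi] is moreover right
    K-invariant, the harmonic relations become the recurrence [psiS], whence
    [phi g = phi 1 * psi (jnum g)], where [jnum g] counts the points of the bottom
    row that [g] sends to the lower half.  So the K-invariants are a line, and the
    spherical function is the average over K of [psi (jnum (k * h^-1))].  As an
    element of H is the set D of columns that it swaps and [nu] is the size of D,
    for each fixed [k] the sum over H is a sum over subsets of
    [alpha ^ |D| psi(|A :&: D|)] with [|A| = p], which is [(1 + alpha)^(l-p) G].
    The Hahn sum has the same value by the Vandermonde identity. *)

Require Import Defs.
From HB Require Import structures.
From mathcomp Require Import all_boot all_order all_algebra all_fingroup.
From mathcomp Require Import mxrepresentation sesquilinear complex reals.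
From mathcomp Require Import zify ring.

Set Implicit Arguments.
Unset Strict Implicit.
Unset Printing Implicit Defensive.

Import Order.TTheory GRing.Theory Num.Theory.
Local Open Scope ring_scope.

(** * Generating function of the Hahn polynomials *)

Section HahnGeneratingFunction.
Variable F : numFieldType.
Implicit Types (l p s : nat) (x : F).

Lemma gbinom_nat (n j : nat) : gbinom (n%:R : F) j = 'C(n, j)%:R.
Proof.
have fact_neq0 : (j`!)%:R != 0 :> F by rewrite pnatr_eq0 -lt0n fact_gt0.
apply: (mulIf fact_neq0); rewrite divfK // -natrM bin_ffact ffact_prod natr_prod.
case: (leqP j n) => [le_jn | lt_nj].
  by apply: eq_bigr => i _; rewrite natrB //; case: i => i /=; lia.
(* For [j > n] the factor of index [n] vanishes in both products. *)
rewrite (bigD1 (Ordinal lt_nj)) //= subrr mul0r.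
by rewrite [RHS](bigD1 (Ordinal lt_nj)) //= subnn mul0r.
Qed.

(* The coefficient of [z ^+ m] in [(1 - z)^(n + d) (1 - z)^(- d)]; the binomial
   coefficient of the second factor is written ['C((d + k).-1, k)] so that it is
   correct for [d = 0]. *)
Lemma signed_vandermonde (n d m : nat) :
  \sum_(j < m.+1) (-1) ^+ j * 'C(n + d, j)%:R * 'C((d + (m - j)).-1, m - j)%:R
  = (-1) ^+ m * 'C(n, m)%:R :> F.
Proof.
elim: d => [|d IHd].
  rewrite big_ord_recr /= big1 => [|[i /= lt_im] _].
    by rewrite subnn addn0 bin0 mulr1 add0r.
  by rewrite add0n (@bin_small (m - i).-1) ?mulr0 //; lia.
rewrite -IHd addnS big_ord_recl /= bin0 !subn0.
under eq_bigr => i _ do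
  rewrite /bump leq0n add1n binS natrD mulrDr mulrDl.
rewrite big_split /= addrA.
have -> : (-1) ^+ 0 * 1%:R * 'C((d.+1 + m).-1, m)%:R +
    \sum_(i < m) (-1) ^+ i.+1 * 'C(n + d, i.+1)%:R *
                 'C((d.+1 + (m - i.+1)).-1, m - i.+1)%:R
  = \sum_(j < m.+1) (-1) ^+ j * 'C(n + d, j)%:R *
       'C((d.+1 + (m - j)).-1, m - j)%:R :> F.
  by rewrite big_ord_recl /= bin0 subn0.
rewrite big_ord_recr [RHS]big_ord_recr /= subnn !bin0 addrAC; congr (_ + _).
rewrite -big_split; apply: eq_bigr => -[i /= lt_im] _.
have -> : (m - i)%N = (m - i.+1).+1 by lia.
rewrite exprS ?addSn ?addnS /= binS natrD; ring.
Qed.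

(** Both sides count the chains of a [j]-subset inside an [m]-subset of [n] points, that is n! / (j!
    (m-j)! (n-m)!). *)
Lemma bin_trinomial (n m j : nat) : (j <= m <= n)%N ->
  ('C(n, m) * 'C(m, j) = 'C(n, j) * 'C(n - j, m - j))%N.
Proof.
case/andP=> le_jm le_mn; have le_jn := leq_trans le_jm le_mn.
have fact_neq0 : (0 < j`! * (m - j)`! * (n - m)`!)%N by rewrite !muln_gt0 !fact_gt0.
apply/eqP; rewrite -(eqn_pmul2r fact_neq0); apply/eqP.
transitivity n`!.
  by rewrite -(bin_fact le_mn) -(bin_fact le_jm); ring.
have := @bin_fact (n - j) (m - j); rewrite subnBA // subnK // => facE.
by rewrite -(bin_fact le_jn) -facE ?leq_sub2r //; ring.
Qed.

(** Multiplication by ['C(l, m)] turns ['C(m, j) / 'C(l, j)] into ['C(l - j, m - j)], which leaves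
    [signed_vandermonde] for [n = l - p + m] and [d = l - m + 1]. *)
Lemma gpoly_coefE l p m : (p <= l)%N -> (m <= p)%N ->
  \sum_(j < m.+1) (-1) ^+ j * 'C(m, j)%:R * 'C(2 * l - p + 1, j)%:R
                  / 'C(l, j)%:R
  = (-1) ^+ m * 'C(l - p + m, m)%:R / 'C(l, m)%:R :> F.
Proof.
move=> le_pl le_mp.
have binl_neq0 i : (i <= l)%N -> 'C(l, i)%:R != 0 :> F.
  by rewrite pnatr_eq0 -lt0n bin_gt0.
have binm_neq0 : 'C(l, m)%:R != 0 :> F by apply: binl_neq0; lia.
apply: (mulIf binm_neq0); rewrite divfK //.
rewrite -(signed_vandermonde (l - p + m) (l - m).+1) mulr_suml.
apply: eq_bigr => -[j /= lt_jm] _; rewrite ltnS in lt_jm.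
have -> : (l - p + m + (l - m).+1 = 2 * l - p + 1)%N by lia.
have -> : (l - m + (m - j) = l - j)%N by lia.
have binE : 'C(m, j)%:R * 'C(l, m)%:R = 'C(l, j)%:R * 'C(l - j, m - j)%:R :> F.
  by rewrite mulrC -!natrM bin_trinomial // lt_jm (leq_trans le_mp).
have /binl_neq0 binj_neq0 : (j <= l)%N by lia.
rewrite mulrAC; apply: (canLR (mulfK binj_neq0)).
rewrite -2!mulrA [_ * 'C(l, m)%:R]mulrC.
transitivity ((-1) ^+ j * 'C(2 * l - p + 1, j)%:R * ('C(m, j)%:R * 'C(l, m)%:R) : F).
  by ring.
by rewrite binE; ring.
Qed.

(** The boolean factor compensates for truncated subtraction: for [m < j] the binomial alone would
    be 1. *)
Lemma shifted_binomial n j x : (j <= n)%N ->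
  x ^+ j * (1 + x) ^+ (n - j)
  = \sum_(m < n.+1) ('C(n - j, m - j) * (j <= m))%:R * x ^+ m.
Proof.
move=> le_jn.
rewrite -(big_mkord predT (fun m => ('C(n - j, m - j) * (j <= m))%:R * x ^+ m)).
rewrite (big_cat_nat (leq0n j) (leqW le_jn)) /=.
rewrite big_nat big1 ?add0r => [|m /andP[_ lt_mj]]; last first.
  by rewrite leqNgt lt_mj muln0 mul0r.
rewrite -[X in _ = \sum_(X <= m < _) _]add0n big_addn subSn // big_mkord.
rewrite exprDn mulr_sumr; apply: eq_bigr => i _.
by rewrite expr1n mul1r addnK leq_addl muln1 -mulr_natl exprD; ring.
Qed.

Lemma hahn_genfun l p x : (p <= l)%N ->
  \sum_(s < l.+1) 'C(l, s)%:R * hahn p s%:R (- l%:R - 1) (- l%:R - 1) l * x ^+ s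
  = (1 + x) ^+ (l - p) * Gpoly p l x.
Proof.
move=> le_pl.
have binl_neq0 i : (i <= l)%N -> 'C(l, i)%:R != 0 :> F.
  by rewrite pnatr_eq0 -lt0n bin_gt0.
(* One of the two factors [1 / 'C(l, j)] of the Hahn coefficient stays here; the other turns
   ['C(l, s) * 'C(s, j)] into ['C(l - j, s - j)], so that the sum over [s] is a binomial
   expansion. *)
pose c j : F := (-1) ^+ j * 'C(p, j)%:R * 'C(2 * l - p + 1, j)%:R / 'C(l, j)%:R.
transitivity (\sum_(j < l.+1) c j * (x ^+ j * (1 + x) ^+ (l - j))).
  transitivity (\sum_(s < l.+1) \sum_(j < l.+1)
      c j * ('C(l - j, s - j) * (j <= s))%:R * x ^+ s).
    apply: eq_bigr => -[s /= lt_sl] _; rewrite /hahn.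
    have -> : - p%:R - (- l%:R - 1) - (- l%:R - 1) - 1 = (2 * l - p + 1)%:R :> F.
      by rewrite natrD natrB ?natrM; [ring | lia].
    have -> : - (- l%:R - 1) - 1 = l%:R :> F by ring.
    rewrite mulr_sumr mulr_suml; apply: eq_bigr => -[j /= lt_jl] _.
    rewrite !gbinom_nat /c; congr (_ * _); rewrite ltnS in lt_jl.
    have := binl_neq0 j lt_jl; case: leqP => [le_js | lt_sj] bin_neq0.
      rewrite muln1.
      have := @bin_trinomial l s j; rewrite le_js -ltnS lt_sl => /(_ isT).
      move/(congr1 (fun n => n%:R : F)); rewrite !natrM => binE.
      have -> : 'C(l - j, s - j)%:R = 'C(l, s)%:R * 'C(s, j)%:R / 'C(l, j)%:R :> F.
        by rewrite binE mulrAC mulfV // mul1r.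
      by field.
    by rewrite /= muln0 (bin_small lt_sj) !mulr0n !mulr0.
  rewrite exchange_big /=; apply: eq_bigr => -[j /= lt_jl] _.
  under eq_bigr do rewrite -mulrA.
  by rewrite -mulr_sumr shifted_binomial.
transitivity (\sum_(j < p.+1) c j * (x ^+ j * (1 + x) ^+ (l - j))).
  rewrite [RHS](big_ord_widen l.+1 (fun j => c j * (x ^+ j * (1 + x) ^+ (l - j)))) //.
  rewrite [RHS]big_mkcond; apply: eq_bigr => -[j /= lt_jl] _.
  by rewrite ltnS; case: leqP => // lt_pj; rewrite /c (bin_small lt_pj) mulr0n mulr0 !mul0r.
(* Once [(1 + x) ^+ (l - p)] is factored out, [x ^+ j * (1 + x) ^+ (p - j)] has degree [p], and
   coefficients of [x ^+ m] are compared for [m <= p]. *)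
transitivity (\sum_(j < p.+1) \sum_(m < p.+1) (1 + x) ^+ (l - p) *
    (c j * ('C(p - j, m - j) * (j <= m))%:R * x ^+ m)).
  apply: eq_bigr => -[j /= lt_jp] _; rewrite ltnS in lt_jp.
  have -> : (l - j = l - p + (p - j))%N by lia.
  rewrite exprD (mulrCA (x ^+ j)) (mulrCA (c j)) (shifted_binomial x lt_jp).
  rewrite -mulr_sumr; congr (_ * _).
  by rewrite mulr_sumr; apply: eq_bigr => m _; rewrite mulrA.
rewrite exchange_big mulr_sumr; apply: eq_bigr => -[m /= lt_mp] _.
rewrite ltnS in lt_mp; rewrite -mulr_sumr -mulr_suml; congr (_ * (_ * _)).
have := gpoly_coefE le_pl lt_mp => coefE.
transitivity ('C(p, m)%:R * ((-1) ^+ m * 'C(l - p + m, m)%:R / 'C(l, m)%:R) : F);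
  last by ring.
rewrite -coefE (big_ord_widen p.+1 (fun j => (-1) ^+ j * 'C(m, j)%:R *
  'C(2 * l - p + 1, j)%:R / 'C(l, j)%:R)) // mulr_sumr [RHS]big_mkcond.
apply: eq_bigr => -[j /= lt_jp] _; rewrite ltnS; case: leqP => [le_jm|]; last first.
  by rewrite /= muln0 mulr0n mulr0.
have := @bin_trinomial p m j; rewrite le_jm lt_mp => /(_ isT).
move/(congr1 (fun n => n%:R : F)); rewrite !natrM => binE.
rewrite /= mulr1 /c.
transitivity ((-1) ^+ j * 'C(2 * l - p + 1, j)%:R / 'C(l, j)%:R *
  ('C(p, j)%:R * 'C(p - j, m - j)%:R) : F); first by ring.
by rewrite -binE; ring.
Qed.

End HahnGeneratingFunction.

(** * The group H *)

Lemma sum_subsets_weight (F : fieldType) (T : finType) (A : {set T})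
    (f : nat -> F) (x : F) :
  \sum_(D : {set T}) x ^+ #|D| * f #|A :&: D|
  = (1 + x) ^+ (#|T| - #|A|) * \sum_(j < #|A|.+1) 'C(#|A|, j)%:R * x ^+ j * f j.
Proof.
(* Both sides are images of generating polynomials under ['X^k |-> f k]. *)
pose L (P : {poly F}) := \sum_(j < #|A|.+1) P`_j * f j.
have L_linear : forall (I : finType) (c : I -> F) (P : I -> {poly F}),
    L (\sum_i c i *: P i) = \sum_i c i * L (P i).
  move=> I c P; rewrite /L; under eq_bigr do rewrite coef_sum mulr_suml.
  rewrite exchange_big; apply: eq_bigr => i _; rewrite mulr_sumr.
  by apply: eq_bigr => j _; rewrite coefZ mulrA.
have LXn k : (k <= #|A|)%N -> L 'X^k = f k.
  move=> le_k; rewrite /L (bigD1 (Ordinal (le_k : k < #|A|.+1)%N)) //= coefXn eqxx mul1r.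
  rewrite big1 ?addr0 // => i ne_ik; rewrite coefXn.
  by rewrite -[_ == k]/(i == Ordinal (le_k : k < #|A|.+1)%N) (negPf ne_ik) mul0r.
have -> : \sum_(D : {set T}) x ^+ #|D| * f #|A :&: D|
    = L (\sum_(D : {set T}) x ^+ #|D| *: 'X^#|A :&: D|).
  rewrite L_linear; apply: eq_bigr => D _.
  by rewrite LXn // subset_leq_card ?subsetIl.
(* Expanding the product chooses for each point whether it lies in [D], with an extra factor ['X] if
   it is also in [A]. *)
have -> : \sum_(D : {set T}) x ^+ #|D| *: 'X^#|A :&: D|
    = \prod_(i : T) (x *: (if i \in A then 'X else 1) + 1) :> {poly F}.
  rewrite bigA_distr; apply: eq_bigr => D _; rewrite -big_mkcond /=.
  rewrite scaler_prod prodr_const; congr (_ *: _).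
  by rewrite -big_mkcondr prodr_const; congr (_ ^+ _); apply: eq_card => i; rewrite !inE andbC.
rewrite (bigID (mem A)) /= (eq_bigr (fun=> 1 + x *: 'X)) => [|i ->]; last exact: addrC.
rewrite [X in _ * X](eq_bigr (fun=> (1 + x)%:P)) => [|i /negPf->]; last first.
  by rewrite addrC alg_polyC -polyC1 -polyCD.
rewrite !prodr_const.
have -> : #|[predC A]| = (#|T| - #|A|)%N by rewrite -(cardC A) addKn.
rewrite -polyC_exp mulrC mul_polyC [(1 + x *: 'X) ^+ _]exprDn.
have -> : (1 + x) ^+ (#|T| - #|A|) *:
    (\sum_(i < #|A|.+1) 1 ^+ (#|A| - i) * (x *: 'X) ^+ i *+ 'C(#|A|, i))
  = \sum_(i < #|A|.+1) ((1 + x) ^+ (#|T| - #|A|) * ('C(#|A|, i)%:R * x ^+ i)) *: 'X^i.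
  rewrite scaler_sumr; apply: eq_bigr => i _.
  by rewrite expr1n mul1r exprZn -scaler_nat !scalerA mulrA.
rewrite L_linear mulr_sumr; apply: eq_bigr => -[i /= lt_i] _.
by rewrite LXn // !mulrA.
Qed.

(** All cycles have length 1 or 2, so [nu] counts the 2-cycles, each made of two moved points. *)
Lemma nu_involution (n : nat) (h : 'S_n) : (forall x, h (h x) = x) ->
  (nu h).*2 = #|[set x | h x != x]|.
Proof.
move=> hK.
have porbitE x : porbit h x = [set x; h x].
  apply/setP=> y; rewrite !inE; apply/porbitP/orP => [[i ->]|].
    elim: i => [|i]; first by rewrite expg0 perm1 eqxx; left.
    by rewrite expgSr permM; case=> /eqP->; rewrite ?hK eqxx; [right | left].
  by case=> /eqP->; [exists 0%N; rewrite expg0 perm1 | exists 1%N; rewrite expg1].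
have card_porbit x : #|porbit h x| = (h x != x).+1.
  by rewrite porbitE cards2 eq_sym.
have nuE : nu h = (\sum_(c in porbits h) (#|c| - 1))%N.
  transitivity (\sum_(1 <= i < n.+1) \sum_(c in porbits h | #|c| == i) (#|c| - 1))%N.
    apply: eq_bigr => i _.
    rewrite (eq_bigr (fun=> (i - 1)%N)) => [|c /andP[_ /eqP->] //].
    rewrite big_const iter_addn_0 /ncycles; congr (_ * _)%N.
    by apply: eq_card => c; rewrite !inE.
  rewrite (exchange_big_dep (mem (porbits h))) /=; last by move=> i c _ /andP[].
  apply: eq_bigr => c /imsetP[x _ ->]; under eq_bigl => i do rewrite imset_f //= eq_sym.
  have le_n : (#|porbit h x| <= n)%N by rewrite (leq_trans (max_card _)) ?card_ord.
  rewrite big_nat1_eq ltnS le_n andbT card_porbit.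
  by case: (h x != x).
rewrite nuE -muln2 big_distrl /= -sum1dep_card [RHS]big_mkcond /=.
rewrite [RHS](partition_big_imset (porbit h)) /=.
apply: eq_bigr => _ /imsetP[x _ ->].
transitivity (\sum_(y in porbit h x) (h y != y))%N; last first.
  apply: eq_big => [y|y _]; last by case: (_ != _).
  by rewrite eq_porbit_mem.
rewrite card_porbit porbitE; case: (altP (h x =P x)) => [hx | ne_hx].
  by rewrite hx setUid big_set1 hx eqxx.
by rewrite big_setU1 ?inE ?big_set1 ?hK 1?eq_sym //= eq_sym ne_hx.
Qed.

(** * Elements of H as sets of swapped columns *)

Section HalfSwaps.
Variable l : nat.
Local Notation n := (2 * l)%N.

Lemma pt_subproof (b : bool) (i : 'I_l) : (b * l + i < n)%N.
Proof. by case: b i => -[i /= lt_il]; lia. Qed.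

(** Coordinates on the [2 * l] points: the column [i], preserved by H, and the half [b], preserved
    by K; [true] stands for the upper half. *)
Definition pt b i : 'I_n := Ordinal (pt_subproof b i).

Lemma residue_subproof (x : 'I_n) : (x %% l < l)%N.
Proof. by rewrite ltn_mod; case: x => x /=; lia. Qed.

Definition residue (x : 'I_n) : 'I_l := Ordinal (residue_subproof x).

Lemma ptE (x : 'I_n) : x = pt (l <= x)%N (residue x).
Proof.
apply: val_inj => /=; have := ltn_ord x.
case: (leqP l x) => [le_lx lt_x | lt_xl _]; last by rewrite /= modn_small.
by rewrite -{2}(subnK le_lx) modnDr modn_small; lia.
Qed.

Lemma residue_pt b i : residue (pt b i) = i.
Proof. by apply: val_inj; rewrite /= modnMDl modn_small. Qed.

Lemma pt_ge b i : (l <= pt b i)%N = b.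
Proof. by case: b i => -[i /= lt_i]; lia. Qed.

Lemma pt_inj b b' i i' : pt b i = pt b' i' -> b = b' /\ i = i'.
Proof.
move=> eq_pt; split; last by rewrite -(residue_pt b i) eq_pt residue_pt.
by rewrite -(pt_ge b i) eq_pt pt_ge.
Qed.

Definition swap_fun (D : {set 'I_l}) (x : 'I_n) : 'I_n :=
  pt ((residue x \in D) (+) (l <= x)%N) (residue x).

Lemma swap_funK D : involutive (swap_fun D).
Proof. by move=> x; rewrite /swap_fun pt_ge residue_pt addbA addbb -ptE. Qed.

Definition swap_perm D : 'S_n := perm (inv_inj (swap_funK D)).

Lemma swap_permE D x : swap_perm D x = pt ((residue x \in D) (+) (l <= x)%N) (residue x).
Proof. by rewrite permE. Qed.

Lemma swap_permV D : (swap_perm D)^-1%g = swap_perm D.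
Proof.
by apply/eqP; rewrite eq_invg_mul; apply/eqP/permP => x; rewrite permM !permE swap_funK.
Qed.

Lemma HsetE (h : 'S_n) : (h \in Hset l) = [forall x, residue (h x) == residue x].
Proof. by rewrite inE. Qed.

Lemma nu_swap_perm D : nu (swap_perm D) = #|D|.
Proof.
apply: double_inj; rewrite nu_involution => [|x]; last by rewrite !permE swap_funK.
have -> : [set x | swap_perm D x != x] = [set pt u.1 u.2 | u in setX [set: bool] D].
  apply/setP=> x; rewrite inE swap_permE [in X in _ != X](ptE x).
  apply/idP/imsetP => [|[[b i] /setXP[_ /= Di] ->]].
    case: (boolP (residue x \in D)) => [Dx _ | _]; last by rewrite addFb eqxx.
    by exists (l <= x, residue x)%N; rewrite ?inE //= -ptE.
  by rewrite residue_pt pt_ge Di; apply/eqP => /pt_inj[]; case: b.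
rewrite card_imset ?cardsX ?cardsT ?card_bool ?mul2n //.
by move=> [b i] [b' i'] /= /pt_inj[-> ->].
Qed.

(** An element of H fixes or exchanges the two points of each column, so it is determined by the
    columns whose lower point it moves. *)
Lemma sum_Hset (V : nmodType) (f : 'S_n -> V) :
  \sum_(h in Hset l) f h = \sum_D f (swap_perm D).
Proof.
pose moved (h : 'S_n) := [set i | h (pt false i) != pt false i].
rewrite (reindex_onto swap_perm moved) => [|h].
  apply: eq_bigl => D; rewrite HsetE; apply/andP; split.
    by apply/forallP=> x; rewrite swap_permE residue_pt.
  apply/eqP/setP=> i; rewrite inE swap_permE residue_pt pt_ge addbF.
  by case: (i \in D); [apply/eqP=> /pt_inj[] | rewrite eqxx].
rewrite HsetE => /forallP residue_h; apply/permP => x.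
rewrite swap_permE inE; set i := residue x.
have h_pt b : {b' | h (pt b i) = pt b' i}.
  exists (l <= h (pt b i))%N.
  by rewrite [LHS]ptE; congr pt; apply/eqP; rewrite (eqP (residue_h _)) residue_pt.
have pt_eq b b' : (pt b i == pt b' i) = (b == b').
  by apply/eqP/eqP => [/pt_inj[] | ->].
have -> : h x = h (pt (l <= x)%N i) by rewrite /i -ptE.
have : h (pt false i) != h (pt true i) by rewrite (inj_eq perm_inj) pt_eq.
have [[b e_f] [b' e_t]] := (h_pt false, h_pt true).
rewrite e_f e_t !pt_eq; case: (l <= x)%N; rewrite ?e_f ?e_t.
  by case: b b' {e_f e_t} => [] [].
by case: b b' {e_f e_t} => [] [].
Qed.

Lemma KsetE (k : 'S_n) : (k \in Kset l) = [forall x, (k x < l) == (x < l)]%N.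
Proof.
have divE (x : 'I_n) : (x %/ l = ~~ (x < l))%N.
  have := ltn_ord x; case: (ltnP x l) => [lt_xl _ | le_lx lt_x]; first by rewrite divn_small.
  by rewrite -(subnK le_lx) divnDr ?dvdnn // divnn divn_small //; lia.
rewrite inE; apply: eq_forallb => x; rewrite !divE.
by do 2 case: (_ < _)%N.
Qed.

End HalfSwaps.

(** * Spherical functions and the Young symmetrizer *)

Section SphericalFunction.
Variables (F : numFieldType) (l p : nat).
Hypothesis le_pl : (p <= l)%N.
Local Notation n := (2 * l)%N.
Local Notation la := [:: (n - p)%N; p].
Implicit Types g h k : 'S_n.

(* Locked, so that [inE] does not unfold membership in [bottom]. *)
Fact bottom_key : unit. Proof. by []. Qed.

Definition bottom : {set 'I_n} :=
  locked_with bottom_key [set x : 'I_n | n - p <= x]%N.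

Lemma bottomE (x : 'I_n) : (x \in bottom) = (n - p <= x)%N.
Proof. by rewrite /bottom locked_withE inE. Qed.

Lemma card_bottom : #|bottom| = p.
Proof.
rewrite /bottom locked_withE -sum1dep_card.
rewrite -(big_mkord (fun x : nat => n - p <= x)%N (fun=> 1%N)).
rewrite (big_cat_nat (leq0n (n - p)) (leq_subr _ _)) /= big_nat_cond big1 => [|i]; last by lia.
rewrite add0n big_nat_cond (eq_bigl (fun i => n - p <= i < n)%N) => [|i]; last by lia.
by rewrite -big_nat sum_nat_const_nat muln1; lia.
Qed.

Lemma card_lower_half : #|[set x : 'I_n | (x < l)%N]| = l.
Proof.
rewrite -sum1dep_card -(big_mkord (fun x : nat => x < l)%N (fun=> 1%N)).
rewrite (big_cat_nat (leq0n l)) /=; last by lia.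
rewrite [X in (_ + X)%N]big_nat_cond [X in (_ + X)%N]big1 => [|i]; last by lia.
rewrite addn0 big_nat_cond (eq_bigl (fun i => 0 <= i < l)%N) => [|i]; last by lia.
by rewrite -big_nat sum_nat_const_nat muln1 subn0.
Qed.

Lemma bottom_ge (x : 'I_n) : x \in bottom -> (l <= x)%N.
Proof. by rewrite bottomE; apply: leq_trans; lia. Qed.

Definition jnum g : nat := #|[set x in bottom | g x < l]%N|.

(** ['C(p, j)%:R * psi j] is the coefficient of [x ^+ j] in [Gpoly p l x]. *)
Definition psi j : F := (-1) ^+ j * 'C(l - p + j, j)%:R / 'C(l, j)%:R.

(** The two integer factors are the numbers of terms of each kind in the harmonic relation. *)
Lemma psiS j : (j < p)%N ->
  (l - j)%:R * psi j.+1 = - ((l - p + j.+1)%:R * psi j).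
Proof.
move=> lt_jp; rewrite /psi.
have binl_neq0 i : (i <= l)%N -> 'C(l, i)%:R != 0 :> F.
  by rewrite pnatr_eq0 -lt0n bin_gt0.
have /binl_neq0 bin_j : (j <= l)%N by lia.
have /binl_neq0 bin_Sj : (j.+1 <= l)%N by lia.
have /(congr1 (fun n => n%:R : F)) := mul_bin_left l j.
have /(congr1 (fun n => n%:R : F)) := mul_bin_diag (l - p + j.+1) j.
rewrite !natrM addnS /= => diagE leftE.
have j_neq0 : j.+1%:R != 0 :> F by rewrite pnatr_eq0.
apply: (mulfI j_neq0); apply: (mulIf bin_j); apply: (mulIf bin_Sj).
transitivity ((-1) ^+ j.+1 * (j.+1%:R * 'C((l - p + j).+1, j.+1)%:R)
   * ((l - j)%:R * 'C(l, j)%:R) : F); first by field.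
rewrite -diagE -leftE exprS; field; exact: bin_j.
Qed.

Lemma jnumM g k : k \in Kset l -> jnum (g * k)%g = jnum g.
Proof.
rewrite KsetE => /forallP kP; apply: eq_card => x.
by rewrite !inE permM (eqP (kP _)).
Qed.

Lemma tperm_Kset (x y : 'I_n) : (x < l)%N = (y < l)%N -> tperm x y \in Kset l.
Proof.
by move=> eq_xy; rewrite KsetE; apply/forallP => z; case: tpermP => // ->; rewrite eq_xy.
Qed.

Lemma row_stabE g :
  (g \in row_stab n la) = [forall x, (g x \in bottom) == (x \in bottom)].
Proof.
have indexE (x : 'I_n) : reshape_index la x = (x \in bottom).
  rewrite bottomE /reshape_index /=; have lt_xn := ltn_ord x.
  have -> : (x.+1 - (n - p) - p == 0)%N by lia.
  by rewrite subn_eq0; case: (leqP (n - p) x).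
rewrite inE; apply: eq_forallb => x; rewrite !indexE.
by do 2 case: (_ \in bottom).
Qed.

Lemma row_stab_imset g : (g \in row_stab n la) = (g @: bottom \subset bottom).
Proof.
rewrite row_stabE; apply/forallP/subsetP => [gP _ /imsetP[x bot_x ->] | sub_g x].
  by rewrite (eqP (gP x)).
have eq_g : g @: bottom = bottom.
  apply/eqP; rewrite eqEcard card_imset ?leqnn ?andbT //; last exact: perm_inj.
  exact/subsetP.
by rewrite -{1}eq_g mem_imset ?eqxx //; apply: perm_inj.
Qed.

(** * Rigidity of row-invariant, K-invariant harmonic functions *)

Section Determined.
Variable phi : 'S_n -> F.
Hypothesis phi_row : forall r g, r \in row_stab n la -> phi (r * g)%g = phi g.
Hypothesis phi_Kset : forall k g, k \in Kset l -> phi (g * k)%g = phi g.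
Hypothesis phi_harmonic : forall b g, b \in bottom ->
  \sum_(y | y \notin bottom :\ b) phi (tperm b y * g)%g = 0.

(** Induction on the number of bottom points sent outside [bottom]. If [b] is one, some [y] outside
    [bottom] is sent into it; both images lie in the upper half, so exchanging them is in K and
    lowers this number. At 0, [g] stabilizes the rows. *)
Lemma spherical_upper g : jnum g = 0%N -> phi g = phi 1%g.
Proof.
have [m lt_m] := ubnP #|[set x in bottom | g x \notin bottom]|.
elim: m g lt_m => // m IHm g; rewrite ltnS => le_m jnum0.
have [sub_g | not_sub] := boolP (g @: bottom \subset bottom).
  by rewrite -[g]mulg1 phi_row // row_stab_imset.
have [y bot_y bot_gy] : exists2 y, y \notin bottom & g y \in bottom.
  have : ~~ (bottom \subset g @: bottom).
    apply: contra not_sub => sub_bot; suff /eqP <- : bottom == g @: bottom by exact: subxx.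
    by rewrite eqEcard sub_bot card_imset ?leqnn //; apply: perm_inj.
  case/subsetPn=> z bot_z not_gz; exists (g^-1%g z); rewrite ?permKV //.
  by apply: contra not_gz => bot_y; apply/imsetP; exists (g^-1%g z); rewrite ?permKV.
case/subsetPn: not_sub => _ /imsetP[b bot_b ->] bot_gb.
have k_K : tperm (g b) (g y) \in Kset l.
  apply: tperm_Kset; rewrite [RHS]ltnNge (bottom_ge bot_gy) /=; apply/negbTE/negP=> lt_gb.
  by move/eqP: jnum0; rewrite cards_eq0 => /eqP/setP/(_ b); rewrite !inE lt_gb bot_b.
rewrite -(phi_Kset _ k_K) IHm ?jnumM //; apply: leq_trans le_m.
apply/proper_card/properP; split; last first.
  by exists b; rewrite inE bot_b // permM tpermL bot_gy.
apply/subsetP=> x; rewrite !inE permM => /andP[bot_x].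
rewrite bot_x; case: tpermP => [/perm_inj eq_xb | /perm_inj eq_xy | _ _] //.
  by rewrite bot_gy.
by rewrite -eq_xy bot_x in bot_y.
Qed.

(* The terms of the harmonic relation at [b] with [g b < l] take the value
   [phi g] when [g y < l], because [tperm b y * g = g * tperm (g b) (g y)], and
   otherwise have one point of [bottom] fewer in the lower half. *)
Lemma spherical_determined g : phi g = phi 1%g * psi (jnum g).
Proof.
move: {2}(jnum g) (erefl (jnum g)) => j; elim: j g => [|j IHj] g jE.
  by rewrite jE /psi !bin0 expr0 mul1r divff ?oner_neq0 // mulr1 spherical_upper.
have [b bot_b lt_gb] : exists2 b, b \in bottom & (g b < l)%N.
  have : (0 < jnum g)%N by rewrite jE.
  by rewrite card_gt0 => /set0Pn[b]; rewrite inE => /andP[]; exists b.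
have jD1 : #|[set x in bottom :\ b | g x < l]%N| = j.
  move: jE; rewrite /jnum (cardsD1 b) !inE lt_gb bot_b add1n => -[<-].
  by apply: eq_card => x; rewrite !inE andbA.
have lt_jp : (j < p)%N.
  by rewrite -card_bottom -jE subset_leq_card //; apply/subsetP=> x; rewrite inE => /andP[].
(* [N1] and [N2] count the terms of the harmonic relation at [b] by the half of [g y]. As [g] sends
   [l] points to the lower half, [j] of which are in [bottom :\ b], [N1 = l - j] and
   [N2 = l - p + j + 1]. *)
pose N1 := #|[set y in ~: (bottom :\ b) | g y < l]%N|.
pose N2 := #|[set y in ~: (bottom :\ b) | ~~ (g y < l)]%N|.
have N1E : (N1 + j = l)%N.
  have := cardsID (bottom :\ b) (g @^-1: [set x : 'I_n | (x < l)%N]).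
  rewrite on_card_preimset ?card_lower_half; last first.
    by apply: onW_bij; exists (g^-1%g) => x; rewrite ?permK ?permKV.
  rewrite addnC => <-; congr (_ + _)%N; first by apply: eq_card => y; rewrite !inE.
  by rewrite -jD1; apply: eq_card => y; rewrite !inE andbC.
have N2E : (N1 + N2 + p.-1 = n)%N.
  have <- : #|bottom :\ b| = p.-1 by rewrite -card_bottom (cardsD1 b bottom) bot_b.
  rewrite -[RHS]card_ord -(cardsC (bottom :\ b)) addnC; congr (_ + _)%N.
  rewrite -(cardsID (g @^-1: [set x : 'I_n | (x < l)%N])); congr (_ + _)%N.
    by apply: eq_card => y; rewrite !inE.
  by apply: eq_card => y; rewrite !inE andbC.
have := phi_harmonic g bot_b; rewrite (bigID (fun y => g y < l)%N) /=.
rewrite (eq_bigr (fun=> phi g)) => [|y /andP[_ lt_gy]]; last first.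
  by rewrite conjgC tpermJ phi_Kset // tperm_Kset // lt_gb lt_gy.
rewrite [X in _ + X](eq_bigr (fun=> phi 1%g * psi j)) => [|y /andP[bot_y ge_gy]]; last first.
  have ne_yb : y != b by apply: contraNneq ge_gy => ->.
  suff jE' : jnum (tperm b y * g) = j by rewrite IHj jE'.
  rewrite -jD1 /jnum; apply: eq_card => x; rewrite !inE permM.
  case: tpermP => [-> | -> | /eqP ne_xb _]; rewrite ?eqxx ?(negPf ge_gy) ?andbF //.
    by move: bot_y; rewrite !inE ne_yb /= => /negPf->.
  by rewrite ne_xb.
rewrite !big_const !iter_addr_0.
have -> : #|[pred y | (y \notin bottom :\ b) && (g y < l)%N]| = (l - j)%N.
  transitivity N1; last by lia.
  by apply: eq_card => y; rewrite !inE.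
have -> : #|[pred y | (y \notin bottom :\ b) && ~~ (g y < l)%N]| = (l - p + j.+1)%N.
  transitivity N2; last by lia.
  by apply: eq_card => y; rewrite !inE.
have lj_neq0 : (l - j)%:R != 0 :> F by rewrite pnatr_eq0; lia.
rewrite jE -[_ *+ (l - j)]mulr_natl -[_ *+ (_ + _)]mulr_natl => /eqP.
(* The relation now gives [(l - j) phi(g) = - (l - p + j + 1) phi(1) psi(j)], to be matched with
   [psiS]. *)
rewrite addr_eq0 => /eqP sum_eq; apply: (mulfI lj_neq0).
by rewrite mulrCA psiS // sum_eq mulrN mulrCA.
Qed.

End Determined.

(** * Coefficients of the Young symmetrizer *)

Lemma mem_imset_perm (T : finType) (s : {perm T}) (A : {set T}) x :
  (x \in s @: A) = (s^-1%g x \in A).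
Proof. by rewrite -{1}[x](permKV s) mem_imset //; apply: perm_inj. Qed.

Definition offset (x : 'I_n) : nat := if x \in bottom then (x - (n - p))%N else x.

Lemma col_stabE g :
  (g \in col_stab n la) = [forall x, offset (g x) == offset x].
Proof.
have offsetE (x : 'I_n) : reshape_offset la x = offset x.
  rewrite /offset bottomE /reshape_offset /reshape_index /=.
  have lt_xn := ltn_ord x; have -> : (x.+1 - (n - p) - p == 0)%N by lia.
  by rewrite subn_eq0; case: (leqP (n - p) x) => _ /=; rewrite ?addn0 ?subn0.
by rewrite inE; apply: eq_forallb => x; rewrite !offsetE.
Qed.

(** Meant for [x] in the bottom row: the point above it in its column. Elsewhere truncated
    subtraction gives 0. *)
Definition top (x : 'I_n) : 'I_n :=
  Ordinal (leq_ltn_trans (leq_subr (n - p) x) (ltn_ord x)).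

Lemma top_lt x : x \in bottom -> (top x < p)%N.
Proof. by rewrite bottomE /=; have := ltn_ord x; lia. Qed.

Lemma top_notin_bottom x : x \in bottom -> top x \notin bottom.
Proof. by move/top_lt; rewrite bottomE; lia. Qed.

Lemma offset_top x : x \in bottom -> offset (top x) = offset x.
Proof. by move=> bot_x; rewrite /offset bot_x (negPf (top_notin_bottom bot_x)). Qed.

Lemma col_stab_tperm x q : x \in bottom ->
  ((q * tperm x (top x))%g \in col_stab n la) = (q \in col_stab n la).
Proof.
move=> bot_x; rewrite !col_stabE; apply: eq_forallb => y; rewrite permM.
by case: tpermP => // ->; rewrite offset_top.
Qed.

(** For fixed [q], [g = r * q] with [r] in the row stabilizer exactly when [g] and [q] give [bottom]
    the same image, for which inclusion suffices by cardinality. So this is the coefficient of [g]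
    in the Young symmetrizer, and it depends only on [g @: bottom]. *)
Definition young_coef g : F :=
  \sum_(q in col_stab n la) (-1) ^+ odd_perm q * (g @: bottom \subset q @: bottom)%:R.

Lemma young_coefE g :
  young_symmetrizer F n la 0 (gring_index [set: 'S_n] g) = young_coef g.
Proof.
rewrite /young_symmetrizer exchange_big summxE; apply: eq_bigr => q _.
rewrite summxE.
transitivity (\sum_(r in row_stab n la) (-1) ^+ odd_perm q * (r == (g * q^-1)%g)%:R : F).
  apply: eq_bigr => r _; rewrite !mxE eqxx /= (can_in_eq (@gring_indexK _ _)) ?inE //.
  by rewrite eq_sym -(inj_eq (mulIg q^-1%g)) mulgK.
rewrite -mulr_sumr; congr (_ * _).
rewrite -[in RHS](mulgKV q g).
have -> : ((g * q^-1 * q)%g @: bottom \subset q @: bottom) = ((g * q^-1)%g \in row_stab n la).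
  rewrite row_stab_imset; apply/subsetP/subsetP => sub x.
    case/imsetP=> y bot_y ->; have := sub (q ((g * q^-1)%g y)).
    by rewrite -permM imset_f // mem_imset_perm permM permK; apply.
  by case/imsetP=> y bot_y ->; rewrite permM imset_f // sub ?imset_f.
case: (boolP (_ \in _)) => [gq_row | not_row].
  rewrite (bigD1 (g * q^-1)%g) //= eqxx big1 ?addr0 // => r /andP[_ /negPf->] //.
by rewrite big1 // => r row_r; case: eqP => // eq_r; rewrite -eq_r row_r in not_row.
Qed.

Lemma young_coef_row r g : r \in row_stab n la -> young_coef (r * g)%g = young_coef g.
Proof.
rewrite row_stabE => /forallP row_r; apply: eq_bigr => q _.
suff -> : (r * g)%g @: bottom = g @: bottom by [].
by apply/setP=> x; rewrite !mem_imset_perm -(eqP (row_r _)) invMg permM permKV.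
Qed.

(* For fixed [q] the sum over [y] collapses to the indicator of
   [g @: (bottom :\ b) \subset q @: bottom]; the [p - 1] points of
   [g @: (bottom :\ b)] miss a column, whose transposition is a sign-reversing
   involution of the column stabilizer. *)
Lemma young_coef_harmonic b g : b \in bottom ->
  \sum_(y | y \notin bottom :\ b) young_coef (tperm b y * g)%g = 0.
Proof.
move=> bot_b; pose W := g @: (bottom :\ b).
have card_bD1 : #|bottom :\ b|.+1 = p by rewrite -card_bottom (cardsD1 b bottom) bot_b.
have cardW : #|W| = #|bottom :\ b| by rewrite card_imset //; apply: perm_inj.
have count_y (q : 'S_n) :
    \sum_(y | y \notin bottom :\ b) ((tperm b y * g)%g @: bottom \subset q @: bottom)%:R
    = (W \subset q @: bottom)%:R :> F.
  set Z := q @: bottom; have cardZ : #|Z| = p.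
    by rewrite card_imset ?card_bottom //; apply: perm_inj.
  transitivity (\sum_(y | y \notin bottom :\ b) (W \subset Z)%:R * (g y \in Z)%:R : F).
    apply: eq_bigr => y not_y; rewrite -natrM mulnb; congr (_%:R); congr nat_of_bool.
    have mem_gt x : x \in bottom -> (tperm b y * g)%g x \in (tperm b y * g)%g @: bottom.
      by move=> bot_x; rewrite imset_f.
    apply/subsetP/andP => [sub | [/subsetP subW Zgy] _ /imsetP[x bot_x ->]].
      split; last by have := sub _ (mem_gt b bot_b); rewrite permM tpermL.
      apply/subsetP=> _ /imsetP[x /setD1P[ne_xb bot_x] ->].
      have := sub _ (mem_gt x bot_x); rewrite permM tpermD // 1?eq_sym //.
      by apply: contraNneq not_y => <-; rewrite in_setD1 ne_xb.
    rewrite permM; case: tpermP => [_ | eq_xy | /eqP ne_xb _] //; last first.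
      by apply: subW; rewrite imset_f // in_setD1 ne_xb.
    move: not_y; rewrite in_setD1 -eq_xy bot_x andbT negbK => /eqP <-.
    by rewrite eq_xy.
  rewrite -mulr_sumr; case: (boolP (W \subset Z)) => [subWZ | _]; last by rewrite mul0r.
  (* [g] maps the admissible [y] onto the complement of [W], where [Z] has exactly one point since
     [#|Z| = p] and [#|W| = p - 1]. *)
  rewrite mul1r (eq_bigl (fun y => g y \notin W)) => [|y]; last first.
    by rewrite mem_imset //; apply: perm_inj.
  rewrite -(@reindex_inj _ _ _ _ _ (fun z => z \notin W) (fun z => (z \in Z)%:R : F)
    (@perm_inj _ g)).
  transitivity (#|Z :\: W|%:R : F).
    rewrite -sumr_const big_mkcond [RHS]big_mkcond; apply: eq_bigr => z _.
    by rewrite in_setD; case: (z \in W); case: (z \in Z).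
  by rewrite cardsD (setIidPr subWZ) cardZ cardW -card_bD1 subSnn.
rewrite exchange_big /=; under eq_bigr do rewrite -mulr_sumr count_y.
have [x bot_x /andP[notW_x notW_top]] :
    exists2 x, x \in bottom & (x \notin W) && (top x \notin W).
  apply/exists_inP; apply: contraT => /exists_inPn noW.
  (* Pigeonhole: if [W] met the column of every bottom point, [f] would inject the [p] bottom points
     into [W]. *)
  pose f y := if y \in W then y else top y.
  have f_inj : {in bottom &, injective f}.
    move=> y z bot_y bot_z; rewrite /f; case: ifP => _; case: ifP => _ // eq_yz.
    - by move: (top_notin_bottom bot_z); rewrite -eq_yz bot_y.
    - by move: (top_notin_bottom bot_y); rewrite eq_yz bot_z.
    move/(congr1 val): eq_yz; rewrite /= => eq_yz; apply: val_inj => /=.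
    by move: bot_y bot_z; rewrite !bottomE; lia.
  have : (#|bottom| <= #|W|)%N.
    rewrite -(card_in_imset f_inj); apply/subset_leq_card/subsetP => _ /imsetP[y bot_y ->].
    by have := noW y bot_y; rewrite negb_and !negbK /f; case: ifP.
  by rewrite cardW card_bottom -card_bD1 ltnn.
set S := LHS; suff eqSN : S = - S.
  by have := mulrn_eq0 S 2; rewrite mulr2n {1}eqSN addNr eqxx => /esym/eqP.
rewrite {1}/S (reindex_inj (mulIg (tperm x (top x)))) /= -sumrN.
have ne_x : x != top x by apply: contraTneq (top_notin_bottom bot_x) => <-; rewrite negbK.
apply: eq_big => [q | q _]; first by rewrite col_stab_tperm.
rewrite odd_permM odd_tperm ne_x addbT signrN mulNr; congr (- (_ * _%:R)); congr nat_of_bool.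
have fixW w : w \in W -> tperm x (top x) w = w.
  by move=> Ww; apply: tpermD; [move: notW_x | move: notW_top]; apply: contraNneq => ->.
apply/subsetP/subsetP => sub w Ww; have := sub w Ww;
  by rewrite !mem_imset_perm invMg tpermV permM fixW.
Qed.

Lemma imset_perm1 (T : finType) (A : {set T}) : (1%g : {perm T}) @: A = A.
Proof. by apply/setP=> x; rewrite mem_imset_perm invg1 perm1. Qed.

(** Only [q = 1] can contribute: [q @: bottom = k @: bottom] lies in the upper half, whereas a
    bottom point that leaves its row goes to a point below [p <= l]. So [q] fixes the bottom row
    pointwise, then the first row too, whose points have distinct columns. *)
Lemma young_coef_Kset k : k \in Kset l -> young_coef k = (k @: bottom \subset bottom)%:R.
Proof.
rewrite KsetE => /forallP kP.
have col1 : 1%g \in col_stab n la.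
  by rewrite col_stabE; apply/forallP => x; rewrite perm1.
rewrite /young_coef (bigD1 1%g) //= odd_perm1 expr0 mul1r big1 => [|q /andP[]].
  by rewrite addr0 imset_perm1.
rewrite col_stabE => /forallP qP; apply: contraNeq; rewrite mulf_eq0 negb_or => /andP[_].
rewrite pnatr_eq0 eqb0 negbK => sub_kq.
have eq_kq : k @: bottom = q @: bottom.
  by apply/eqP; rewrite eqEcard sub_kq !card_imset ?leqnn //; apply: perm_inj.
have q_bot y : y \in bottom -> q y = y.
  move=> bot_y; have : q y \in k @: bottom by rewrite eq_kq imset_f.
  case/imsetP=> x bot_x qyE; have := kP x; rewrite -qyE !ltnNge (bottom_ge bot_x).
  move=> /eqP /negbFE ge_qy; have := qP y; rewrite /offset bot_y.
  have bot_qy : q y \in bottom.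
    apply: contraT => not_bot; have := qP y; rewrite /offset bot_y (negPf not_bot).
    by move/eqP=> qyE'; have := top_lt bot_y; rewrite /= -qyE'; lia.
  rewrite bot_qy => /eqP eq_off; apply: val_inj; move: eq_off bot_y bot_qy.
  by rewrite !bottomE /=; lia.
apply/eqP/permP => x; rewrite perm1; case: (boolP (x \in bottom)) => [/q_bot // | not_x].
have not_qx : q x \notin bottom.
  apply: contra not_x => bot_qx; have := q_bot _ bot_qx => /perm_inj <-.
  by [].
by apply: val_inj; have := qP x; rewrite /offset (negPf not_x) (negPf not_qx) => /eqP.
Qed.

Lemma Kset1 : 1%g \in Kset l.
Proof. by rewrite KsetE; apply/forallP=> x; rewrite perm1. Qed.

Lemma KsetV k : (k^-1%g \in Kset l) = (k \in Kset l).
Proof.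
suff KV k' : k' \in Kset l -> k'^-1%g \in Kset l.
  by apply/idP/idP => /KV //; rewrite invgK.
rewrite !KsetE => /forallP kP; apply/forallP=> x.
by rewrite -{2}[x](permKV k') (eqP (kP _)).
Qed.

Lemma KsetMr k g : k \in Kset l -> ((g * k)%g \in Kset l) = (g \in Kset l).
Proof.
rewrite !KsetE => /forallP kP; apply: eq_forallb => x.
by rewrite permM (eqP (kP _)).
Qed.

(** All terms are 0 or 1, and [k = 1] contributes 1. Hence the K-average of the Young symmetrizer is
    nonzero. *)
Lemma sum_young_coef_neq0 : \sum_(k in Kset l) young_coef k != 0.
Proof.
rewrite (eq_bigr (fun k : 'S_n => (k @: bottom \subset bottom)%:R)) => [|k]; last first.
  exact: young_coef_Kset.
rewrite (bigD1 1%g) ?Kset1 //= gt_eqF // ltr_wpDr ?sumr_ge0 //.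
by rewrite imset_perm1 subxx ltr01.
Qed.

End SphericalFunction.

(** * K-invariants of the Specht module *)

Section SpechtModule.
Variables (C : numClosedFieldType) (l p : nat).
Hypothesis le_pl : (p <= l)%N.
Local Notation n := (2 * l)%N.
Local Notation la := [:: (n - p)%N; p].
Local Notation S := (specht C n la).
Local Notation V := 'rV[C]_(\rank (specht_mx C n la)).
Implicit Types (g h k : 'S_n) (v e : V).

Definition coef v g : C := val_submod v 0 (gring_index [set: 'S_n] g).

Lemma regular_coef (v : 'rV[C]_(gcard [set: 'S_n])) g x :
  (v *m regular_repr C [set: 'S_n] g) 0 (gring_index [set: 'S_n] x)
  = v 0 (gring_index [set: 'S_n] (x * g^-1)%g).
Proof.
rewrite mxE (bigD1 (gring_index [set: 'S_n] (x * g^-1)%g)) //= big1 => [|i ne_i].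
  by rewrite !mxE gring_indexK ?inE // mulgKV !eqxx mulr1 addr0.
rewrite !mxE eqxx /=; case: eqP => [eq_i|]; last by rewrite mulr0.
case/eqP: ne_i; rewrite -[LHS](@gring_valK _ [set: 'S_n]).
congr gring_index; apply: (canRL (mulgK _)).
by rewrite -(@gring_indexK _ [set: 'S_n]%G (enum_val i * g)%g) ?inE // -eq_i gring_indexK ?inE.
Qed.

Lemma coefJ v h g : coef (v *m S h) g = coef v (g * h^-1)%g.
Proof. by rewrite /coef val_submodJ ?inE // regular_coef. Qed.

Lemma coefZ a v g : coef (a *: v) g = a * coef v g.
Proof. by rewrite /coef linearZ /= mxE. Qed.

Lemma coefB v w g : coef (v - w) g = coef v g - coef w g.
Proof. by rewrite /coef linearB /= !mxE. Qed.

Lemma coef_sum (I : finType) (P : pred I) (f : I -> V) g :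
  coef (\sum_(i | P i) f i) g = \sum_(i | P i) coef (f i) g.
Proof. by rewrite /coef linear_sum summxE. Qed.

Lemma coef_inj v : (forall g, coef v g = 0) -> v = 0.
Proof.
move=> v0; apply: val_submod_inj; rewrite linear0; apply/rowP=> i.
by rewrite [RHS]mxE -(v0 (enum_val i)) /coef gring_valK.
Qed.

(** The symmetrizer generates the module, so coefficient functions are combinations of right
    translates of [young_coef] and inherit its row invariance and harmonicity. *)
Lemma coef_young v :
  exists a : 'S_n -> C, forall g, coef v g = \sum_x a x * young_coef C p (g * x^-1)%g.
Proof.
have /cyclic_mxP[A /envelop_mxP[a ->] vE] := val_submodP v.
exists a => g; rewrite /coef vE mulmx_sumr summxE.
rewrite big_mkcond; apply: eq_bigr => x _; rewrite inE.
by rewrite -scalemxAr mxE regular_coef young_coefE.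
Qed.

Lemma coef_row v r g : r \in row_stab n la -> coef v (r * g)%g = coef v g.
Proof.
move=> row_r; have [a aE] := coef_young v; rewrite !aE.
by apply: eq_bigr => x _; rewrite -mulgA young_coef_row.
Qed.

Lemma coef_harmonic v b g : b \in bottom l p ->
  \sum_(y | y \notin bottom l p :\ b) coef v (tperm b y * g)%g = 0.
Proof.
move=> bot_b; have [a aE] := coef_young v; under eq_bigr do rewrite aE.
rewrite exchange_big big1 // => x _; rewrite -mulr_sumr.
under eq_bigr do rewrite -mulgA.
by rewrite young_coef_harmonic ?mulr0.
Qed.

Lemma coef_Kinvariant v k g : K_invariant v -> k \in Kset l -> coef v (g * k)%g = coef v g.
Proof. by move=> v_K K_k; rewrite -[v in LHS](v_K k K_k) coefJ mulgK. Qed.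

Lemma coef_spherical v g : K_invariant v -> coef v g = coef v 1%g * psi C l p (jnum p g).
Proof.
move=> v_K; apply: (spherical_determined le_pl) => [r h|k h|b h].
- exact: coef_row.
- exact: coef_Kinvariant.
- exact: coef_harmonic.
Qed.

(** Both coefficient functions are multiples of [psi (jnum g)]: the K-invariants span at most a
    line. *)
Lemma Kinvariant_proportional v e : K_invariant v -> K_invariant e ->
  coef e 1%g *: v = coef v 1%g *: e.
Proof.
move=> v_K e_K; apply/eqP; rewrite -subr_eq0; apply/eqP/coef_inj => g.
by rewrite coefB !coefZ (coef_spherical g v_K) (coef_spherical g e_K); ring.
Qed.

Lemma coef1_neq0 e : K_invariant e -> e != 0 -> coef e 1%g != 0.
Proof.
move=> e_K; apply: contraNneq => e1_0; apply/eqP/coef_inj => g.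
by rewrite (coef_spherical g e_K) e1_0 mul0r.
Qed.

(** * Averaging over K *)

Lemma card_Kset_neq0 : #|Kset l|%:R != 0 :> C.
Proof. by rewrite pnatr_eq0 -lt0n; apply/card_gt0P; exists 1%g; apply: Kset1. Qed.

Definition Kproj : 'M[C]_(\rank (specht_mx C n la)) :=
  #|Kset l|%:R^-1 *: \sum_(k in Kset l) S k.

Lemma KprojJ k : k \in Kset l -> Kproj *m S k = Kproj.
Proof.
move=> K_k; rewrite /Kproj -scalemxAl mulmx_suml; congr (_ *: _).
rewrite [RHS](reindex_inj (mulIg k)) /=.
by apply: eq_big => [k'|k' _]; [rewrite KsetMr | rewrite repr_mxM ?inE].
Qed.

Lemma Kproj_invariant m (W : 'M[C]_(m, \rank (specht_mx C n la))) i :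
  K_invariant (row i (W *m Kproj)).
Proof. by move=> k K_k; rewrite -row_mul -mulmxA KprojJ. Qed.

Lemma omega_trace h : omega C la h = \tr (Kproj *m S h).
Proof.
rewrite /omega /Kproj -scalemxAl mxtraceZ mulmx_suml raddf_sum; congr (_ * _).
by apply: eq_bigr => k _; rewrite /chi repr_mxM ?inE.
Qed.

(** As the invariants lie on a line, [Kproj] has the rank one form [w *m e]. The trace of
    [Kproj *m S h] and the eigenvalue are then both the scalar [e *m S h *m w]. *)
Lemma omega_eigen e h : K_invariant e -> e != 0 ->
  e *m S h *m Kproj = omega C la h *: e.
Proof.
move=> e_K e_neq0; have e1_neq0 := coef1_neq0 e_K e_neq0.
pose w : 'cV[C]_(\rank (specht_mx C n la)) :=
  \col_i (coef (row i Kproj) 1%g / coef e 1%g).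
have KprojE : Kproj = w *m e.
  apply/row_matrixP => i; rewrite row_mul; apply: (scalerI e1_neq0).
  have rowK : K_invariant (row i Kproj) by rewrite -[Kproj]mul1mx; apply: Kproj_invariant.
  rewrite (Kinvariant_proportional rowK e_K).
  have -> : row i w = (coef (row i Kproj) 1%g / coef e 1%g)%:M.
    by apply/matrixP=> a b; rewrite !ord1 !mxE eqxx.
  by rewrite mul_scalar_mx scalerA mulrCA mulfV // mulr1.
rewrite omega_trace KprojE -[w *m e *m _]mulmxA mxtrace_mulC mulmxA trace_mx11.
by rewrite -mul_scalar_mx -mx11_scalar.
Qed.

(** The K-average of the Young symmetrizer works: its coefficient at 1 is the average of
    [young_coef] over K. *)
Lemma Kinvariant_exists : exists2 e : V, K_invariant e & e != 0.
Proof.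
pose Y := in_submod (specht_mx C n la) (young_symmetrizer C n la).
have coefY g : coef Y g = young_coef C p g.
  by rewrite /coef in_submodK ?cyclic_mx_id // young_coefE.
exists (row 0 (Y *m Kproj)); first exact: Kproj_invariant.
have -> : row 0 (Y *m Kproj) = Y *m Kproj by apply/rowP=> i; rewrite mxE.
apply/eqP=> YK0; have := sum_young_coef_neq0 C le_pl; apply/negP; rewrite negbK.
have : coef (Y *m Kproj) 1%g = 0 by rewrite YK0 /coef linear0 mxE.
rewrite /Kproj -scalemxAr coefZ mulmx_sumr coef_sum => /eqP.
rewrite mulf_eq0 invr_eq0 (negPf card_Kset_neq0) /= => /eqP sumK.
rewrite -[X in _ == X]sumK (reindex_inj invg_inj); apply/eqP.
by apply: eq_big => [k|k _]; rewrite ?KsetV // coefJ coefY mul1g.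
Qed.

(** Coefficients at 1 are compared in [omega_eigen]; those of [e] are known from
    [coef_spherical]. *)
Lemma omegaE h :
  omega C la h = #|Kset l|%:R^-1 * \sum_(k in Kset l) psi C l p (jnum p (k * h^-1)%g).
Proof.
have [e e_K e_neq0] := Kinvariant_exists.
apply: (mulIf (coef1_neq0 e_K e_neq0)).
rewrite -coefZ -omega_eigen // /Kproj -scalemxAr coefZ mulmx_sumr coef_sum -mulrA.
congr (_ * _); rewrite mulr_suml [RHS](reindex_inj invg_inj).
apply: eq_big => [k|k _]; rewrite ?KsetV //.
by rewrite !coefJ mul1g (coef_spherical _ e_K) mulrC.
Qed.

(** Invariance of [dot] and [e] makes [dot (e *m S h *m S k) e] independent of [k] in K, so [Kproj]
    can be inserted, and [omega_eigen] produces the factor [omega]. *)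
Lemma Fdot_omega (dot : {dot V for Num.conj}) e (alpha : C) :
  invariant_dot dot -> K_invariant e -> dot e e = 1 ->
  Fdot dot e alpha = Fomega l la alpha.
Proof.
move=> dotG e_K dot_e; apply: eq_bigr => h _; congr (_ * _).
have e_neq0 : e != 0.
  by apply: contra_eq_neq dot_e => ->; rewrite linear0l eq_sym oner_neq0.
transitivity (dot (e *m S h *m Kproj) e); last first.
  by rewrite omega_eigen // linearZl_LR /= dot_e mulr1.
rewrite /Kproj -scalemxAr linearZl_LR /= mulmx_sumr linear_sumlz.
apply: (canRL (mulKf card_Kset_neq0)).
rewrite (eq_bigr (fun=> dot (e *m S h) e)) => [|k K_k].
  by rewrite sumr_const mulr_natl.
by rewrite -[RHS](dotG k) (e_K k K_k).
Qed.

(** [k] keeps the bottom row in the upper half, so it sends its points to distinct columns, which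
    form a set [A] of size [p]. If [h] swaps the columns in [D], then [k * h^-1] sends a bottom
    point to the lower half exactly when its column under [k] is in [D]. *)
Lemma sum_Hset_jnum (f : nat -> C) (alpha : C) k : k \in Kset l ->
  \sum_(h in Hset l) alpha ^+ nu h * f (jnum p (k * h^-1)%g)
  = (1 + alpha) ^+ (l - p) * \sum_(j < p.+1) 'C(p, j)%:R * alpha ^+ j * f j.
Proof.
rewrite KsetE => /forallP kP; rewrite sum_Hset.
have k_ge x : x \in bottom l p -> (l <= k x)%N.
  by move/(bottom_ge le_pl); rewrite leqNgt [(l <= k x)%N]leqNgt (eqP (kP x)).
pose A := [set residue (k x) | x in bottom l p].
have residue_inj : {in bottom l p &, injective (fun x => residue (k x))}.
  move=> x y bot_x bot_y /= eq_res; apply: (@perm_inj _ k).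
  by rewrite [k x]ptE [k y]ptE eq_res !k_ge.
have cardA : #|A| = p by rewrite card_in_imset ?card_bottom.
have := sum_subsets_weight A f alpha; rewrite cardA card_ord => <-; apply: eq_bigr => D _.
rewrite nu_swap_perm swap_permV; congr (_ * f _).
have -> : A :&: D = [set residue (k x) | x in [set x in bottom l p | residue (k x) \in D]].
  apply/setP=> i; rewrite inE; apply/andP/imsetP => [[/imsetP[x bot_x ->] Dx] | [x]].
    by exists x; rewrite // inE bot_x.
  rewrite inE => /andP[bot_x Dx] ->; split=> //.
  exact: (imset_f (fun x => residue (k x))).
rewrite card_in_imset => [|x y]; last first.
  by rewrite !inE => /andP[bot_x _] /andP[bot_y _]; apply: residue_inj.
apply: eq_card => x; rewrite !inE; apply: andb_id2l => bot_x.
by rewrite permM swap_permE ltnNge pt_ge k_ge // addbT negbK.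
Qed.

(** The sum over H is the same for every [k], so the average over K disappears. *)
Lemma Fomega_genfun (alpha : C) :
  Fomega l la alpha = (1 + alpha) ^+ (l - p) * Gpoly p l alpha.
Proof.
rewrite /Fomega; under eq_bigr do rewrite omegaE mulrCA mulr_sumr.
rewrite -mulr_sumr exchange_big /=.
rewrite (eq_bigr (fun=> (1 + alpha) ^+ (l - p) * Gpoly p l alpha)) => [|k K_k].
  by rewrite sumr_const -[_ * Gpoly _ _ _ *+ _]mulr_natl mulKf // card_Kset_neq0.
rewrite sum_Hset_jnum //; congr (_ * _); apply: eq_bigr => j _.
by rewrite /psi; ring.
Qed.

End SpechtModule.

Theorem theorem3p1 (R : realType) (l p : nat) (alpha : R[i])
    (l_gt0 : (0 < l)%N) (le_pl : (p <= l)%N) :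
  let la := [:: (2 * l - p)%N; p] in
  [/\ forall (dot : {dot 'rV[R[i]]_(\rank (specht_mx R[i] (2 * l) la))
                      for Num.conj})
             (e : 'rV[R[i]]_(\rank (specht_mx R[i] (2 * l) la))),
        invariant_dot dot -> K_invariant e -> dot e e = 1 ->
        Fdot dot e alpha = Fomega l la alpha,
      Fomega l la alpha
        = \sum_(s < l.+1)
            'C(l, s)%:R * hahn p s%:R (- l%:R - 1) (- l%:R - 1) l * alpha ^+ s
    & \sum_(s < l.+1)
          'C(l, s)%:R * hahn p s%:R (- l%:R - 1) (- l%:R - 1) l * alpha ^+ s
        = (1 + alpha) ^+ (l - p) * Gpoly p l alpha].
Proof.
split; last exact: hahn_genfun.
  by move=> dot e; apply: Fdot_omega.
by rewrite hahn_genfun //; apply: Fomega_genfun.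
Qed.
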